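(* Let $n,m,l\in\mathbb{N}_{>0}$, $\mathcal{M}=\{A_1,\dots,A_m\}\subset\mathbb{R}^{n\times n}$, and $\gamma^*>0$. Let $P\succ 0$ be an optimal solution of the problem $\mathrm{Opt}(\omega_N)$ (for some sample $\omega_N$ and some $\eta>0$), and suppose that there is a Borel set $\tilde{\mathbb{S}}\subset\mathbb{S}$ with $\sigma^{n-1}(\tilde{\mathbb{S}})\le\tilde\varepsilon$ such that $$(\mathbf{A_j}x)^TP\,\mathbf{A_j}x\le(\gamma^* )^{2l}x^TPx\quad\text{for all }x\in\mathbb{S}\setminus\tilde{\mathbb{S}}\text{ and all }\mathbf{j}\in\{1,\dots,m\}^l.$$ Then $$\rho(\mathcal{M})\le\frac{\gamma^*}{\sqrt[l]{\delta\!\left(\frac{\tilde\varepsilon\,\kappa(P)}{2}\right)}},\qquad \kappa(P)=\sqrt{\frac{\det(P)}{\lambda_{\min}(P)^n}}.$$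
   Context: $\mathbb{S},\mathbb{B}$: Euclidean unit sphere and closed unit ball in $\mathbb{R}^n$. Uniform spherical measure: $\sigma^{n-1}(X)=\lambda(\{tx:x\in X,t\in[0,1]\})/\lambda(\mathbb{B})$, $\lambda$ Lebesgue measure. For $\mathbf{j}=(j_1,\dots,j_l)$, $\mathbf{A_j}=A_{j_l}\cdots A_{j_1}$. Joint spectral radius: $\rho(\mathcal{M})=\lim_{k\to\infty}\max\{\|A_{i_1}\cdots A_{i_k}\|^{1/k}:A_{i_j}\in\mathcal{M}\}$. A sample $\omega_N$ is a finite subset $\{(x_i,\mathbf{j}_i)\}_{i=1}^N$ of $\mathbb{S}\times\{1,\dots,m\}^l$; $\gamma^*(\omega_N)$ is the optimal value of $\min\gamma$ s.t. $(\mathbf{A_j}x)^TP\mathbf{A_j}x\le\gamma^{2l}x^TPx$ for all $(x,\mathbf{j})\in\omega_N$, $P\succ0$, $\gamma\ge0$. For $\eta>0$, $\mathrm{Opt}(\omega_N)$ is: minimize $\lambda_{\max}(P)$ over symmetric $P$ subject to $(\mathbf{A_j}x)^TP\mathbf{A_j}x\le((1+\eta)\gamma^*(\omega_N))^{2l}x^TPx$ for all $(x,\mathbf{j})\in\omega_N$ and $P\succeq I$. For $X\subset\mathbb{S}$, $\Delta(X)=\sup\{r\in[0,1]: r\mathbb{B}\subset\mathrm{conv}(\mathbb{S}\setminus X)\}$ (sup of empty set $=0$), and for $e\ge0$, $\delta(e)=\inf\{\Delta(X): X\subset\mathbb{S}\text{ Borel}, \sigma^{n-1}(X)\le e\}$;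 for $e\le 1/2$ this equals $\sqrt{1-I^{-1}(2e;\frac{n-1}{2},\frac12)}$ with $I$ the regularized incomplete beta function. Convention: $\gamma^*/0=+\infty$. *)

(* Defs.v *)
From HB Require Import structures.
From mathcomp Require Import all_boot all_order all_algebra.
From mathcomp Require Import all_classical all_reals all_analysis.
Set Implicit Arguments. Unset Strict Implicit. Unset Printing Implicit Defensive.
Import Order.TTheory GRing.Theory Num.Theory.
Import numFieldNormedType.Exports.
Local Open Scope classical_set_scope.
Local Open Scope ring_scope.

Section Defs.
Variables (R : realType) (n : nat).
Local Notation vec := 'cV[R]_n.

Definition qf (P : 'M[R]_n) (x : vec) : R := (x^T *m P *m x) 0 0.

Definition enorm (x : vec) : R := Num.sqrt (\sum_i (x i 0) ^+ 2).
Definition Sph : set vec := [set x | enorm x = 1].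
Definition Ball : set vec := [set x | enorm x <= 1].

Definition symmetric (P : 'M[R]_n) := P^T = P.
Definition posdef (P : 'M[R]_n) := symmetric P /\ forall x, x != 0 -> 0 < qf P x.
Definition psd (P : 'M[R]_n) := symmetric P /\ forall x, 0 <= qf P x.

(* extreme eigenvalues (for symmetric P all eigenvalues are real) *)
Definition lam_max (P : 'M[R]_n) : R := sup [set a | eigenvalue P a].
Definition lam_min (P : 'M[R]_n) : R := inf [set a | eigenvalue P a].

Definition kappa (P : 'M[R]_n) : R := Num.sqrt (\det P / lam_min P ^+ n).

Definition borel (X : set vec) : Prop := <<s [set A : set vec | open A] >> X.

Definition box (a b : vec) : set vec := [set x | forall i, a i 0 <= x i 0 <= b i 0].
Definition box_vol (a b : vec) : R := \prod_i (b i 0 - a i 0).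
Definition lebesgue_n (E : set vec) : \bar R :=
  ereal_inf [set s | exists a b : nat -> vec,
     (forall k i, a k i 0 <= b k i 0) /\
     E `<=` \bigcup_k box (a k) (b k) /\
     s = (\sum_(k <oo) (box_vol (a k) (b k))%:E)%E].

Definition cone (X : set vec) : set vec :=
  [set y | exists x t, X x /\ 0 <= t <= 1 /\ y = t *: x].
Definition sigma_sph (X : set vec) : R :=
  fine (lebesgue_n (cone X)) / fine (lebesgue_n Ball).

Definition conv (Y : set vec) : set vec :=
  [set z | exists (k : nat) (p : 'I_k -> vec) (w : 'I_k -> R),
     (forall i, Y (p i)) /\ (forall i, 0 <= w i) /\ \sum_i w i = 1 /\
     z = \sum_i w i *: p i].

(* Delta(X) = sup{ r in [0,1] : r B subset conv(S \ X) }, sup of empty set = 0 *)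
Definition Delta (X : set vec) : R :=
  sup [set r | 0 <= r <= 1 /\ (fun x => r *: x) @` Ball `<=` conv (Sph `\` X)].
Definition delta (e : R) : R :=
  inf [set Delta X | X in [set X | borel X /\ X `<=` Sph /\ sigma_sph X <= e]].

Definition opnorm (M : 'M[R]_n) : R := sup [set enorm (M *m x) | x in Sph].

Variable m : nat.
Variable A : 'I_m -> 'M[R]_n.

(* A_j = A_{j_l} ... A_{j_1} for j = (j_1, ..., j_l) *)
Definition Aw (k : nat) (j : k.-tuple 'I_m) : 'M[R]_n :=
  foldl (fun M i => A i *m M) 1%:M (tval j).

Definition jsr : R :=
  limn (fun k : nat => powR (\big[Num.max/0]_(w : k.-tuple 'I_m) opnorm (Aw w)) k%:R^-1).

Variable l : nat.
Definition is_sample (om : seq (vec * l.-tuple 'I_m)) : Prop :=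
  uniq om /\ forall p, p \in om -> Sph p.1.

Definition gamma_star (om : seq (vec * l.-tuple 'I_m)) : R :=
  inf [set g | 0 <= g /\ exists P, posdef P /\
        forall p, p \in om -> qf P (Aw p.2 *m p.1) <= g ^+ (2 * l) * qf P p.1].

Definition opt_feasible (om : seq (vec * l.-tuple 'I_m)) (eta : R) (P : 'M[R]_n) :=
  symmetric P /\ psd (P - 1%:M) /\
  forall p, p \in om ->
    qf P (Aw p.2 *m p.1) <= ((1 + eta) * gamma_star om) ^+ (2 * l) * qf P p.1.
Definition opt_solution (om : seq (vec * l.-tuple 'I_m)) (eta : R) (P : 'M[R]_n) :=
  opt_feasible om eta P /\ forall Q, opt_feasible om eta Q -> lam_max P <= lam_max Q.

End Defs.

(* Main.v *)
(* Write P = L^T L and put y = L x. The hypothesis says that each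
   M_j = L A_j L^-1 satisfies |M_j y| <= gs^l |y| whenever y does not lie on the
   image of a ray through St. Bad unit vectors y lie in lambda_min^(-1/2) L (cone St),
   whose volume is at most kappa P times that of cone St. Badness is invariant
   under y |-> -y, so a cap {c . y > s} of bad vectors comes with its disjoint
   opposite; hence the cap has measure at most eps * kappa P / 2, and
   delta <= Delta(cap) <= s. So for every unit c and s < delta there is a good unit
   vector g with c . g > s. Taking c along M_j^T u gives
   delta |M_j^T u| <= gs^l |u|, so |M_j| <= gs^l / delta, and iterating over words
   of length k l bounds the joint spectral radius.

   lebesgue_n is an outer measure defined by covers with boxes; its behaviour
   under linear maps and its additivity across a hyperplane are read off covers. *)
Require Import Defs.
From HB Require Import structures.
From mathcomp Require Import all_boot all_order all_algebra.
From mathcomp Require Import all_classical all_reals all_analysis.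
From mathcomp Require Import ring lra.
Import Order.TTheory GRing.Theory Num.Theory.
Import numFieldNormedType.Exports.
Local Open Scope classical_set_scope.
Local Open Scope ring_scope.

Set Implicit Arguments.
Unset Strict Implicit.
Unset Printing Implicit Defensive.

(** * The outer measure defined by boxes *)

(** A cover is packed as one sequence of pairs, so that [choice] can select covers for countably
    many sets at once. *)
Definition boxcover {R : realType} {n : nat} (E : set 'cV[R]_n)
    (G : nat -> 'cV[R]_n * 'cV[R]_n) : Prop :=
  (forall k i, (G k).1 i 0 <= (G k).2 i 0) /\
  E `<=` \bigcup_k box (G k).1 (G k).2.

Lemma box_vol_ge0 (R : realType) (n : nat) (a b : 'cV[R]_n) :
  (forall i, a i 0 <= b i 0) -> 0 <= box_vol a b.
Proof. by move=> ab; apply: prodr_ge0 => i _; rewrite subr_ge0. Qed.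

Lemma boxcover_vol_ge0 (R : realType) (n : nat) (E : set 'cV[R]_n) G :
  boxcover E G -> forall k, (0 <= (box_vol (G k).1 (G k).2)%:E)%E.
Proof. by move=> [G0 _] k; rewrite lee_fin box_vol_ge0. Qed.

Lemma lebesgue_n_le_cover (R : realType) (n : nat) (E : set 'cV[R]_n) G :
  boxcover E G ->
  (lebesgue_n E <= \sum_(k <oo) (box_vol (G k).1 (G k).2)%:E)%E.
Proof.
move=> [G1 G2]; apply: ereal_inf_lbound.
by exists (fun k => (G k).1), (fun k => (G k).2).
Qed.

Lemma le_lebesgue_n (R : realType) (n : nat) (E : set 'cV[R]_n) (x : \bar R) :
  (forall G, boxcover E G ->
     (x <= \sum_(k <oo) (box_vol (G k).1 (G k).2)%:E)%E) ->
  (x <= lebesgue_n E)%E.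
Proof.
move=> h; apply: le_ereal_inf_tmp => _ [a [b [ab [Eab ->]]]].
by apply: (h (fun k => (a k, b k))).
Qed.

Lemma lebesgue_n_ge0 (R : realType) (n : nat) (E : set 'cV[R]_n) :
  (0 <= lebesgue_n E)%E.
Proof.
by apply: le_lebesgue_n => G /boxcover_vol_ge0 G0; apply: nneseries_ge0.
Qed.

Lemma le_lebesgue_n_subset (R : realType) (n : nat) (E F : set 'cV[R]_n) :
  E `<=` F -> (lebesgue_n E <= lebesgue_n F)%E.
Proof.
move=> EF; apply: le_lebesgue_n => G [G0 FG]; apply: lebesgue_n_le_cover.
by split => //; apply: subset_trans FG.
Qed.

Lemma lebesgue_n_cover_adherent (R : realType) (n : nat) (E : set 'cV[R]_n)
    (e : R) : lebesgue_n E != +oo%E -> 0 < e ->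
  exists G, boxcover E G /\
    (\sum_(k <oo) (box_vol (G k).1 (G k).2)%:E <= lebesgue_n E + e%:E)%E.
Proof.
move=> Eoo e0.
have /(lb_ereal_inf_adherent e0) : lebesgue_n E \is a fin_num.
  by rewrite ge0_fin_numE ?lebesgue_n_ge0// ltey.
move=> [_ [a [b [ab [Eab ->]]]] xS].
by exists (fun k => (a k, b k)); split => //; exact: ltW.
Qed.

(** Covers with excess e / 2^(k+1) are chosen for each [E k] and merged into one sequence through a
    bijection between [nat] and [nat * nat]. *)
Lemma lebesgue_n_bigcup (R : realType) (n : nat) (E : nat -> set 'cV[R]_n) :
  (lebesgue_n (\bigcup_k E k) <= \sum_(k <oo) lebesgue_n (E k))%E.
Proof.
have [[i ioo]|] := pselect (exists i, lebesgue_n (E i) = +oo%E).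
  rewrite (eseries_pinfty _ _ ioo) ?leey// => k _.
  by rewrite -ltNye (lt_le_trans _ (lebesgue_n_ge0 _)).
rewrite -forallNE => Eoo.
apply/lee_addgt0Pr => e e0.
rewrite (le_trans _ (epsilon_trick _ _ _))//; last 2 first.
- by move=> k; exact: lebesgue_n_ge0.
- exact: ltW.
have e2 k : 0 < e / (2 ^ k.+1)%:R by rewrite divr_gt0// ltr0n expn_gt0.
have [G PG] := choice (fun k =>
  @lebesgue_n_cover_adherent _ _ (E k) _ (introN eqP (Eoo k)) (e2 k)).
pose v (p : nat * nat) : \bar R := (box_vol (G p.1 p.2).1 (G p.1 p.2).2)%:E.
have v0 p : (0 <= v p)%E by exact: (boxcover_vol_ge0 (PG p.1).1).
apply: (@le_trans _ _ (\esum_(p in setT) v p)).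
  have /card_esym/ppcard_eqP[f] := card_nat2.
  apply: (le_trans (@lebesgue_n_le_cover _ _ _ (fun k => G (f k).1 (f k).2) _)).
    split => [k i|]; first exact: (PG _).1.1.
    move=> t [i _] /((PG i).1.2) [j _ Gt]; exists (f^-1%FUN (i, j)) => //.
    by rewrite invK ?inE.
  rewrite -[leLHS]/(\sum_(k <oo) v (f k))%E.
  rewrite nneseries_esumT// -(reindex_esum setT setT f)//.
rewrite (_ : esum _ _ = \sum_(i <oo) \sum_(j <oo) v (i, j))%E; last first.
  rewrite nneseries_esumT; last by move=> i; exact: nneseries_ge0.
  under [RHS]eq_esum do rewrite nneseries_esumT//.
  rewrite esum_esum//= (_ : _ `*`` _ = setT); last by apply/seteqP; split.
  by apply: eq_esum => -[].
apply: lee_nneseries => i _; first by move=> _; apply: nneseries_ge0.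
exact: (PG i).2.
Qed.

(** * Cutting boxes along coordinate hyperplanes *)

Lemma le_of_eq (d : Order.disp_t) (T : porderType d) (x y : T) :
  x = y -> (x <= y)%O.
Proof. by move=> ->. Qed.

Definition upd_coord (R : realType) (n : nat) (i : 'I_n) (c : R) (x : 'cV[R]_n) :
  'cV[R]_n := \col_j (if j == i then c else x j 0).

Lemma box_vol_upd (R : realType) (n : nat) (i : 'I_n) (c d : R) (a b : 'cV[R]_n) :
  box_vol (upd_coord i c a) (upd_coord i d b) =
  (d - c) * \prod_(j | j != i) (b j 0 - a j 0).
Proof.
rewrite /box_vol (bigD1 i)//= !mxE eqxx; congr (_ * _).
by apply: eq_bigr => j /negPf ji; rewrite !mxE ji.
Qed.

Lemma lebesgue_n_split (R : realType) (n : nat) (i : 'I_n) (E : set 'cV[R]_n) :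
  (lebesgue_n (E `&` [set y : 'cV[R]_n | (0 <= y i 0)%R]) +
   lebesgue_n (E `&` [set y : 'cV[R]_n | (y i 0 <= 0)%R]) <= lebesgue_n E)%E.
Proof.
apply: le_lebesgue_n => G cG; have [ab EG] := cG.
(* Both endpoints are clipped, so a box on one side of the hyperplane leaves a piece of width zero
   on the other, and the two widths always add up. *)
pose U k := (upd_coord i (Num.max ((G k).1 i 0) 0) (G k).1,
             upd_coord i (Num.max ((G k).2 i 0) 0) (G k).2).
pose D k := (upd_coord i (Num.min ((G k).1 i 0) 0) (G k).1,
             upd_coord i (Num.min ((G k).2 i 0) 0) (G k).2).
have cU : boxcover (E `&` [set y | 0 <= y i 0]) U.
  split=> [k j|y [Ey y0]].
    by rewrite !mxE; case: eqP => // _; rewrite le_max2.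
  have [k _ Gky] := EG _ Ey; exists k => // j.
  rewrite !mxE; case: eqP => [->|_]; last exact: Gky.
  by have /andP[? ?] := Gky i; rewrite ge_max le_max y0; apply/andP; split; lra.
have cD : boxcover (E `&` [set y | y i 0 <= 0]) D.
  split=> [k j|y [Ey y0]].
    by rewrite !mxE; case: eqP => // _; rewrite le_min2.
  have [k _ Gky] := EG _ Ey; exists k => // j.
  rewrite !mxE; case: eqP => [->|_]; last exact: Gky.
  have /andP[h1 h2] := Gky i.
  by rewrite le_min ge_min y0 h1 h2.
apply: (le_trans (leeD (lebesgue_n_le_cover cU) (lebesgue_n_le_cover cD))).
rewrite -nneseriesD; last 2 first.
- by move=> k _ _; exact: (boxcover_vol_ge0 cU).
- by move=> k _ _; exact: (boxcover_vol_ge0 cD).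
apply: lee_nneseries => k _.
  by move=> _; rewrite adde_ge0// ?(boxcover_vol_ge0 cU)// (boxcover_vol_ge0 cD).
rewrite -EFinD lee_fin !box_vol_upd /box_vol [leRHS](bigD1 i)//= -mulrDl.
have mm (x : R) : Num.max x 0 = x - Num.min x 0 by have := addr_max_min x 0; lra.
by rewrite !mm; apply: le_of_eq; congr (_ * _); lra.
Qed.

Lemma lebesgue_n_finite_cover (R : realType) (n N : nat) (E : set 'cV[R]_n)
    (a b : nat -> 'cV[R]_n) : (0 < n)%N ->
  (forall k i, a k i 0 <= b k i 0) ->
  (forall y, E y -> exists2 k, (k < N)%N & box (a k) (b k) y) ->
  (lebesgue_n E <= (\sum_(0 <= k < N) box_vol (a k) (b k))%:E)%E.
Proof.
move=> n0 ab Eab.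
(* The padding is a one-point box; its volume is zero because [n] is positive, the empty product
   being one. *)
pose G k := if (k < N)%N then (a k, b k) else (0, 0).
have cG : boxcover E G.
  split=> [k i|y /Eab [k kN yk]].
    by rewrite /G; case: ifP => _ /=; [exact: ab | rewrite lexx].
  by exists k => //; rewrite /G kN.
apply: (le_trans (lebesgue_n_le_cover cG)).
rewrite (nneseries_split 0 N); last by move=> k _; exact: (boxcover_vol_ge0 cG).
rewrite eseries0 ?adde0; last first.
  move=> k; rewrite add0n leqNgt => /negPf kN _; rewrite /G kN /=.
  congr (_%:E); rewrite /box_vol.
  by rewrite (bigD1 (Ordinal n0))//= subrr mul0r.
rewrite add0n sumEFin lee_fin; apply: le_of_eq.
by apply: eq_big_nat => k /andP[_ kN]; rewrite /G kN.
Qed.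

Lemma exists_slice (R : realType) (N : nat) (a h y : R) :
  a <= y <= a + N.+1%:R * h -> exists2 r, (r < N.+1)%N &
  a + r%:R * h <= y <= a + r.+1%:R * h.
Proof.
elim: N => [|N IH] /andP[y1 y2].
  by exists 0%N => //; rewrite mul0r addr0 y1.
have [le|lt] := leP y (a + N.+1%:R * h).
  have [|r rN ?] := IH; first by rewrite y1.
  by exists r => //; exact: ltnW.
by exists N.+1 => //; rewrite (ltW lt).
Qed.

(** The images of the boxes covering [E] cover the image of [E], and countable subadditivity sums
    their bounds. *)
Lemma lebesgue_n_image_le (R : realType) (n : nat) (f : 'cV[R]_n -> 'cV[R]_n)
    (c : R) : 0 < c ->
  (forall a b : 'cV[R]_n, (forall i, a i 0 <= b i 0) ->
     (lebesgue_n (f @` box a b) <= (c * box_vol a b)%:E)%E) ->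
  forall E, (lebesgue_n (f @` E) <= c%:E * lebesgue_n E)%E.
Proof.
move=> c0 fbox E; rewrite -lee_pdivrMl//; apply: le_lebesgue_n => G cG.
rewrite lee_pdivrMl// -nneseriesZl; last first.
  by move=> k _; exact: (boxcover_vol_ge0 cG).
apply: (@le_trans _ _ (lebesgue_n (\bigcup_k (f @` box (G k).1 (G k).2)))).
  apply: le_lebesgue_n_subset => _ [x Ex <-].
  by have [k _ Gx] := cG.2 _ Ex; exists k => //; exists x.
apply: (le_trans (lebesgue_n_bigcup _)); apply: lee_nneseries.
  by move=> k _ _; exact: lebesgue_n_ge0.
by move=> k _; rewrite -EFinM; apply: fbox; exact: cG.1.
Qed.

(** The elementary map y |-> y + y_k (u - e_k); scalings of one coordinate and shears both have this
    form. *)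
Definition col_repl (R : realType) (n : nat) (k : 'I_n) (u : 'cV[R]_n) : 'M[R]_n :=
  \matrix_(i, j) (if j == k then u i 0 else (i == j)%:R).

Lemma col_replE (R : realType) (n : nat) (k : 'I_n) (u : 'cV[R]_n) p
    (y : 'M[R]_(n, p)) i j :
  (col_repl k u *m y) i j = (if i == k then 0 else y i j) + u i 0 * y k j.
Proof.
rewrite !mxE (bigD1 k)//= !mxE eqxx addrC; congr (_ + _).
have [->|ik] := eqVneq i k.
  by apply: big1 => r rk; rewrite mxE (negPf rk) eq_sym (negPf rk) mul0r.
rewrite (bigD1 i)//= mxE (negPf ik) eqxx mul1r big1 ?addr0// => r /andP[rk ri].
by rewrite mxE (negPf rk) eq_sym (negPf ri) mul0r.
Qed.

(** The cofactors along column [k] do not see that column, so they are those of the identity, read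
    off its adjugate. *)
Lemma det_col_repl (R : realType) (n : nat) (k : 'I_n) (u : 'cV[R]_n) :
  \det (col_repl k u) = u k 0.
Proof.
rewrite (expand_det_col _ k).
have cof i : cofactor (col_repl k u) i k = cofactor 1%:M i k :> R.
  rewrite /cofactor; congr (_ * \det _); apply/matrixP => r s.
  by rewrite !mxE eq_sym (negPf (neq_lift _ _)).
have adj1 i : cofactor (1%:M : 'M[R]_n) i k = (k == i)%:R.
  have := mul1mx (\adj (1%:M : 'M[R]_n)).
  by rewrite mul_mx_adj det1 => /matrixP/(_ k i); rewrite !mxE.
rewrite (bigD1 k)//= big1 => [|i ik]; last first.
  by rewrite cof adj1 eq_sym (negPf ik) mulr0.
by rewrite cof adj1 !mxE !eqxx mulr1 addr0.
Qed.

(* Cut the box into N slices orthogonal to coordinate k: each slice is mapped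
   into a box whose sides exceed the right ones by O(1/N). *)
Lemma lebesgue_n_col_repl_box (R : realType) (n : nat) (k : 'I_n)
    (u a b : 'cV[R]_n) : (forall i, a i 0 <= b i 0) ->
  (lebesgue_n (mulmx (col_repl k u) @` box a b) <=
   (`|u k 0| * box_vol a b)%:E)%E.
Proof.
move=> ab; have n0 : (0 < n)%N by case: n k {u a b ab} => // -[].
pose w i := b i 0 - a i 0.
have w0 i : 0 <= w i by rewrite subr_ge0.
(* At 1/N this is the product of the sides, other than side [k], of the boxes around N slices; at 0
   it is that product for the original box. *)
pose p : {poly R} := \prod_(i | i != k) ((w i)%:P + (2 * `|u i 0| * w k) *: 'X).
have slices N : (lebesgue_n (mulmx (col_repl k u) @` box a b) <=
    (`|u k 0| * w k * p.[N.+1%:R^-1])%:E)%E.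
  pose h := w k / N.+1%:R.
  have h0 : 0 <= h by rewrite divr_ge0.
  have Nh : N.+1%:R * h = w k by rewrite mulrC divfK// pnatr_eq0.
  (* Bounding box of the image of slice [r]: coordinate [k] is u_k y_k, and any other coordinate is
     y_i + u_i y_k, where y_k varies by at most [h]. *)
  pose al r : 'cV[R]_n := \col_i (if i == k
    then u k 0 * (a k 0 + r%:R * h) + Num.min 0 (u k 0 * h)
    else a i 0 + u i 0 * (a k 0 + r%:R * h) - `|u i 0| * h).
  pose be r : 'cV[R]_n := \col_i (if i == k
    then u k 0 * (a k 0 + r%:R * h) + Num.max 0 (u k 0 * h)
    else b i 0 + u i 0 * (a k 0 + r%:R * h) + `|u i 0| * h).
  have uh i : 0 <= `|u i 0| * h by rewrite mulr_ge0.
  apply: (le_trans (@lebesgue_n_finite_cover _ _ N.+1 _ al be n0 _ _)).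
  - move=> r i; rewrite !mxE; case: eqP => _.
      by rewrite lerD2l le_max ge_min lexx.
    by have := ab i; have := uh i; lra.
  - move=> _ [y aby <-].
    have [|r rN /andP[r1 r2]] := @exists_slice _ N (a k 0) h (y k 0).
      by rewrite Nh /w addrC subrK; exact: aby.
    exists r => // i; rewrite col_replE !mxE.
    set t := y k 0 - (a k 0 + r%:R * h).
    have t0 : 0 <= t by rewrite subr_ge0.
    have th : t <= h by move: r2; rewrite /t -natr1 mulrDl mul1r; lra.
    have -> : y k 0 = a k 0 + r%:R * h + t by rewrite /t addrC subrK.
    have [->|ik] := eqVneq i k.
      rewrite add0r [u k 0 * (_ + t)]mulrDr !lerD2l ge_min le_max.
      have [u0|u0] := leP 0 (u k 0).
        by rewrite mulr_ge0//= ler_wpM2l// orbT.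
      by rewrite [u k 0 * t <= 0]nmulr_rle0// t0 orTb andbT ler_nM2l// th orbT.
    have ut : `|u i 0 * t| <= `|u i 0| * h by rewrite normrM (ger0_norm t0) ler_wpM2l.
    have /andP[u1 u2] : - (`|u i 0| * h) <= u i 0 * t <= `|u i 0| * h by rewrite -ler_norml.
    have /andP[y1 y2] := aby i.
    by apply/andP; split; lra.
  - rewrite lee_fin (eq_bigr (fun=> `|u k 0| * h * p.[N.+1%:R^-1])); last first.
      move=> r _; rewrite /box_vol (bigD1 k)//= !mxE eqxx; congr (_ * _).
        have -> : `|u k 0| * h = `|u k 0 * h| by rewrite normrM (ger0_norm h0).
        case: (lerP 0 (u k 0 * h)) => uh0; last by rewrite ltr0_norm//; lra.
        by rewrite ger0_norm//; lra.
      rewrite /p horner_prod; apply: eq_bigr => i ik; rewrite !mxE (negPf ik) hornerD hornerZ hornerX hornerC.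
      rewrite /h /w. field.
      by rewrite addrC natr1 pnatr_eq0.
    rewrite sumr_const_nat subn0 -mulr_natl.
    by rewrite -Nh; apply: le_of_eq; ring.
(* The slices get thinner, and the polynomial is continuous at 0. *)
apply/lee_addgt0Pr => e e0.
have pN : (`|u k 0| * w k * p.[N.+1%:R^-1]) @[N --> \oo] --> `|u k 0| * w k * p.[0].
  apply: cvgMr; apply: (@cvg_comp _ _ _ (fun N : nat => N.+1%:R^-1) (horner p)).
    exact: cvg_harmonic.
  exact: continuous_horner.
have -> : `|u k 0| * box_vol a b = `|u k 0| * w k * p.[0].
  rewrite /box_vol (bigD1 k)//= -mulrA; congr (_ * (_ * _)).
  by rewrite horner_prod; apply: eq_bigr => i _; rewrite hornerD hornerZ hornerX hornerC mulr0 addr0.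
have /cvgrPdist_lt/(_ e e0)[N _ /(_ N (leqnn N))] := pN.
rewrite ltr_norml => /andP[h1 _].
by apply: (le_trans (slices N)); rewrite -EFinD lee_fin; lra.
Qed.

(** * Volume and linear maps *)

Lemma lebesgue_n_col_repl (R : realType) (n : nat) (k : 'I_n) (u : 'cV[R]_n)
    (E : set 'cV[R]_n) : u k 0 != 0 ->
  (lebesgue_n (mulmx (col_repl k u) @` E) <= `|u k 0|%:E * lebesgue_n E)%E.
Proof.
move=> uk; apply: lebesgue_n_image_le; first by rewrite normr_gt0.
exact: lebesgue_n_col_repl_box.
Qed.

Lemma lebesgue_n_mulmxM (R : realType) (n : nat) (S T : 'M[R]_n) :
  (forall E, (lebesgue_n (mulmx S @` E) <= `|\det S|%:E * lebesgue_n E)%E) ->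
  (forall E, (lebesgue_n (mulmx T @` E) <= `|\det T|%:E * lebesgue_n E)%E) ->
  forall E : set 'cV[R]_n,
    (lebesgue_n (mulmx (S *m T) @` E) <= `|\det (S *m T)|%:E * lebesgue_n E)%E.
Proof.
move=> hS hT E; rewrite det_mulmx normrM EFinM -muleA.
rewrite (_ : mulmx (S *m T) @` E = mulmx S @` (mulmx T @` E)); last first.
  by rewrite image_comp; congr (_ @` _); apply/funext => x /=; rewrite mulmxA.
by apply: (le_trans (hS _)); apply: lee_wpmul2l => //; rewrite lee_fin.
Qed.

(** Otherwise column [k] is a combination of the preceding unit columns, and [v] is the resulting
    kernel vector. *)
Lemma unitmx_pivot (R : realType) (n : nat) (T : 'M[R]_n) (k : 'I_n) :
  T \in unitmx -> (forall i j : 'I_n, (j < k)%N -> T i j = (i == j)%:R) ->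
  exists2 i : 'I_n, (k <= i)%N & T i k != 0.
Proof.
move=> uT Tid; apply: contrapT => noT.
have Tk0 (i : 'I_n) : (k <= i)%N -> T i k = 0.
  by move=> ki; apply/eqP; apply: contrapT => /negP Tik; apply: noT; exists i.
pose v : 'cV[R]_n := \col_j (if j == k then 1 else if (j < k)%N then - T j k else 0).
have Tv : T *m v = 0.
  apply/colP => i; rewrite !mxE (bigD1 k)//= !mxE eqxx mulr1.
  have [ik|ki] := ltnP i k; last first.
    rewrite Tk0// add0r big1// => j jk; rewrite mxE (negPf jk).
    case: ltnP => [lt|_]; last by rewrite mulr0.
    rewrite Tid// (_ : (i == j) = false) ?mul0r//.
    by apply: contraTF ki => /eqP ->; rewrite -ltnNge.
  have nik : i != k by rewrite neq_ltn ik.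
  rewrite (bigD1 i)//= mxE (negPf nik) ik (Tid i i)// eqxx mul1r big1 ?addr0 ?subrr//.
  move=> j /andP[jk ji]; rewrite mxE (negPf jk).
  case: ltnP => [lt|_]; last by rewrite mulr0.
  by rewrite Tid// eq_sym (negPf ji) mul0r.
have : v = 0 by rewrite -(mulKmx uT v) Tv mulmx0.
by move/colP/(_ k); rewrite !mxE eqxx => /eqP; rewrite oner_eq0.
Qed.

(* Gaussian elimination by columns writes T as a product of column
   replacements. *)
Lemma lebesgue_n_mulmx (R : realType) (n : nat) (T : 'M[R]_n) (E : set 'cV[R]_n) :
  T \in unitmx -> (lebesgue_n (mulmx T @` E) <= `|\det T|%:E * lebesgue_n E)%E.
Proof.
move=> uT.
(* [d] counts the columns, from the right, that may still differ from those of the identity. *)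
suff H d : forall T : 'M[R]_n, T \in unitmx ->
    (forall i j : 'I_n, (j < n - d)%N -> T i j = (i == j)%:R) ->
    forall E, (lebesgue_n (mulmx T @` E) <= `|\det T|%:E * lebesgue_n E)%E.
  by apply: (H n) => // i j; rewrite subnn ltn0.
elim: d => [|d IH] {}T {}uT Tid {}E.
  have -> : T = 1%:M by apply/matrixP => i j; rewrite Tid ?subn0 ?mxE.
  rewrite det1 normr1 mul1e; apply: le_lebesgue_n_subset => _ [x Ex <-].
  by rewrite mul1mx.
have [nd|dn] := leqP n d.
  by apply: IH => // i j jd; apply: Tid; move: jd; rewrite (eqP nd).
have kP : (n - d.+1 < n)%N by rewrite ltn_subrL/= (leq_ltn_trans _ dn).
pose k := Ordinal kP.
have nd1 : (n - d = k.+1)%N by rewrite /= -subSn// subSS.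
(* With a nonzero pivot, dividing on the left by the column replacement [C] makes column [k] a unit
   column and keeps the earlier ones. *)
have pivot (S : 'M[R]_n) : S \in unitmx ->
    (forall i j : 'I_n, (j < k)%N -> S i j = (i == j)%:R) -> S k k != 0 ->
    forall E, (lebesgue_n (mulmx S @` E) <= `|\det S|%:E * lebesgue_n E)%E.
  move=> uS Sid Skk; pose C := col_repl k (col k S).
  have detC : \det C = S k k by rewrite det_col_repl mxE.
  have uC : C \in unitmx by rewrite unitmxE detC unitfE.
  rewrite -[S](mulKVmx uC); apply: lebesgue_n_mulmxM => {E}E.
    by rewrite det_col_repl; apply: lebesgue_n_col_repl; rewrite mxE.
  apply: IH; first by rewrite unitmx_mul unitmx_inv uC.
  move=> i j; rewrite nd1 ltnS => jk.
  have colS : col j S = col j C.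
    apply/colP => r; rewrite !mxE; case: eqVneq => [->//|njk].
    by rewrite Sid// ltn_neqAle jk andbT.
  have : col j (invmx C *m S) = col j 1%:M.
    by rewrite colE -mulmxA -colE colS colE mulmxA mulVmx// -colE.
  by move/colP/(_ i); rewrite !mxE => <-.
have [i ki Tik] := @unitmx_pivot _ _ T k uT Tid.
have [Tkk|Tkk] := eqVneq (T k k) 0; last exact: pivot.
have nik : i != k by apply: contraNneq Tik => ->; rewrite Tkk.
(* [C c] adds c times row [i] to row [k]: [C 1] brings a nonzero entry to the pivot position and
   [C (-1)] undoes this. *)
pose C (c : R) : 'M[R]_n := col_repl i (\col_j ((j == i)%:R + c * (j == k)%:R)).
have detC c : \det (C c) = 1 by rewrite det_col_repl mxE eqxx (negPf nik) mulr0 addr0.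
have uC c : C c \in unitmx by rewrite unitmxE detC unitr1.
have CE c (S : 'M[R]_n) r s : (C c *m S) r s = S r s + c * (r == k)%:R * S i s.
  rewrite col_replE mxE; case: eqVneq => [->|_]; last by rewrite add0r.
  by rewrite add0r mulrDl mul1r.
have -> : T = C (-1) *m (C 1 *m T).
  by apply/matrixP => r s; rewrite !CE (negPf nik) mulr0n; move: (_%:R) => x; ring.
apply: lebesgue_n_mulmxM => {E}E.
  rewrite det_col_repl; apply: lebesgue_n_col_repl.
  by rewrite mxE eqxx (negPf nik) mulr0 addr0 oner_neq0.
apply: pivot; first by rewrite unitmx_mul uC.
  move=> r s sk; rewrite CE !Tid// (_ : (i == s) = false) ?mulr0 ?addr0//.
  by apply: contraTF ki => /eqP ->; rewrite -ltnNge.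
by rewrite CE Tkk eqxx add0r !mul1r.
Qed.

(** This is the upper bound for the inverse matrix, applied to the image. *)
Lemma lebesgue_n_le_mulmx (R : realType) (n : nat) (T : 'M[R]_n)
    (E : set 'cV[R]_n) : T \in unitmx ->
  (`|\det T|%:E * lebesgue_n E <= lebesgue_n (mulmx T @` E))%E.
Proof.
move=> uT; have d0 : 0 < `|\det T| by rewrite normr_gt0 -unitfE -unitmxE.
rewrite -lee_pdivlMl// -normfV -det_inv.
rewrite {1}(_ : E = mulmx (invmx T) @` (mulmx T @` E)).
  by apply: lebesgue_n_mulmx; rewrite unitmx_inv.
rewrite image_comp -[LHS]image_id; congr (_ @` _); apply/funext => x /=.
by rewrite mulKmx.
Qed.

(** * Inner products and antipodal sets *)

Definition dotp (R : realType) (n : nat) (x y : 'cV[R]_n) : R := (x^T *m y) 0 0.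

Lemma dotpE (R : realType) (n : nat) (x y : 'cV[R]_n) :
  dotp x y = \sum_i x i 0 * y i 0.
Proof. by rewrite /dotp mxE; apply: eq_bigr => i _; rewrite mxE. Qed.

(* A linear change of variables turns c into a coordinate vector, and boxes can
   be cut along a coordinate hyperplane. *)
Lemma lebesgue_n_antipodal (R : realType) (n : nat) (c : 'cV[R]_n)
    (S E : set 'cV[R]_n) : c != 0 -> (forall y, S y -> 0 <= dotp c y) ->
  (forall y, S y -> E y /\ E (- y)) ->
  (lebesgue_n S + lebesgue_n S <= lebesgue_n E)%E.
Proof.
move=> c0 Sc SE.
have [i ci] : exists i, c i 0 != 0.
  apply: contrapT => noc; move/eqP: c0; apply; apply/colP => i; rewrite mxE.
  by apply/eqP; apply: contrapT => /negP ci; apply: noc; exists i.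
(* The identity with row [i] replaced by [c], so that coordinate [i] of T y is c . y. *)
pose T := (col_repl i c)^T.
have detT : \det T = c i 0 by rewrite det_tr det_col_repl.
have uT : T \in unitmx by rewrite unitmxE detT unitfE.
have Ti y : (T *m y) i 0 = dotp c y.
  rewrite mxE dotpE; apply: eq_bigr => j _.
  by rewrite !mxE eqxx.
have d0 : 0 < `|c i 0| by rewrite normr_gt0.
rewrite -(@lee_pmul2l _ `|c i 0|%:E)// muleDr//; last first.
  by rewrite ge0_adde_def// inE lebesgue_n_ge0.
apply: (@le_trans _ _ (lebesgue_n (mulmx T @` E))); last first.
  by rewrite -detT; apply: lebesgue_n_mulmx.
apply: le_trans (lebesgue_n_split i _); apply: leeD.
  rewrite -detT; apply: (le_trans (lebesgue_n_le_mulmx S uT)).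
  apply: le_lebesgue_n_subset => _ [y Sy <-]; split; last by rewrite /= Ti Sc.
  by exists y => //; have [] := SE _ Sy.
(* The second copy of [S] is sent by - T, of the same absolute determinant, into the lower half
   space. *)
have -> : `|c i 0| = `|\det (- T)|.
  by rewrite -scaleN1r detZ normrM normrX normrN normr1 expr1n mul1r detT.
have uNT : - T \in unitmx.
  by rewrite -scaleN1r unitmxZ// unitrN1.
apply: (le_trans (lebesgue_n_le_mulmx S uNT)).
apply: le_lebesgue_n_subset => _ [y Sy <-]; split.
  by exists (- y); [have [] := SE _ Sy | rewrite mulNmx mulmxN].
by rewrite /= mulNmx mxE Ti oppr_le0 Sc.
Qed.

(** The ball lies in the cube [-1,1]^n. Finiteness makes [fine] in [sigma_sph] return the true
    measure. *)
Lemma lebesgue_n_bounded (R : realType) (n : nat) (E : set 'cV[R]_n) :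
  (0 < n)%N -> E `<=` @Ball R n -> lebesgue_n E \is a fin_num.
Proof.
move=> n0 EB; rewrite ge0_fin_numE ?lebesgue_n_ge0//.
pose one : 'cV[R]_n := const_mx 1.
apply: (@le_lt_trans _ _ (\sum_(0 <= k < 1) box_vol (- one) one)%:E); last exact: ltry.
apply: (@lebesgue_n_finite_cover _ _ 1 _ (fun=> - one) (fun=> one)) => //.
  by move=> _ i; rewrite !mxE; lra.
move=> y /EB yB; exists 0%N => // i; rewrite !mxE -ler_norml.
rewrite -sqrtr_sqr; apply: le_trans yB; rewrite ler_wsqrtr//.
by rewrite (bigD1 i)//= lerDl sumr_ge0// => j _; exact: sqr_ge0.
Qed.

(** * Gram factorization and the least eigenvalue *)

Lemma dotpC (R : realType) (n : nat) (x y : 'cV[R]_n) : dotp x y = dotp y x.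
Proof. by rewrite !dotpE; apply: eq_bigr => i _; rewrite mulrC. Qed.

Lemma dotpDr (R : realType) (n : nat) (x y z : 'cV[R]_n) :
  dotp x (y + z) = dotp x y + dotp x z.
Proof. by rewrite /dotp mulmxDr mxE. Qed.

Lemma dotpZr (R : realType) (n : nat) (a : R) (x y : 'cV[R]_n) :
  dotp x (a *: y) = a * dotp x y.
Proof. by rewrite /dotp -scalemxAr mxE. Qed.

Lemma dotpZl (R : realType) (n : nat) (a : R) (x y : 'cV[R]_n) :
  dotp (a *: x) y = a * dotp x y.
Proof. by rewrite dotpC dotpZr dotpC. Qed.

Lemma dotpDl (R : realType) (n : nat) (x y z : 'cV[R]_n) :
  dotp (x + y) z = dotp x z + dotp y z.
Proof. by rewrite dotpC dotpDr !(dotpC z). Qed.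

Lemma dotp_trmx (R : realType) (n : nat) (M : 'M[R]_n) (x y : 'cV[R]_n) :
  dotp (M^T *m x) y = dotp x (M *m y).
Proof. by rewrite /dotp trmx_mul trmxK mulmxA. Qed.

Lemma dotp_ge0 (R : realType) (n : nat) (x : 'cV[R]_n) : 0 <= dotp x x.
Proof. by rewrite dotpE; apply: sumr_ge0 => i _; rewrite -expr2 sqr_ge0. Qed.

Lemma dotp_eq0 (R : realType) (n : nat) (x : 'cV[R]_n) : (dotp x x == 0) = (x == 0).
Proof.
apply/eqP/eqP => [|->]; last by rewrite /dotp mulmx0 mxE.
rewrite dotpE => /psumr_eq0P h; apply/colP => i; rewrite mxE.
apply/eqP; rewrite -sqrf_eq0 expr2 h// => j _.
by rewrite -expr2 sqr_ge0.
Qed.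

Lemma dotp_gt0 (R : realType) (n : nat) (x : 'cV[R]_n) : (0 < dotp x x) = (x != 0).
Proof. by rewrite lt_def dotp_eq0 dotp_ge0 andbT. Qed.

Lemma enormE (R : realType) (n : nat) (x : 'cV[R]_n) :
  enorm x = Num.sqrt (dotp x x).
Proof. by rewrite dotpE. Qed.

Lemma enorm_ge0 (R : realType) (n : nat) (x : 'cV[R]_n) : 0 <= enorm x.
Proof. exact: sqrtr_ge0. Qed.

Lemma enorm_sqr (R : realType) (n : nat) (x : 'cV[R]_n) : enorm x ^+ 2 = dotp x x.
Proof. by rewrite enormE sqr_sqrtr ?dotp_ge0. Qed.

Lemma enorm_eq0 (R : realType) (n : nat) (x : 'cV[R]_n) : (enorm x == 0) = (x == 0).
Proof. by rewrite -sqrf_eq0 enorm_sqr dotp_eq0. Qed.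

Lemma enorm0 (R : realType) (n : nat) : enorm (0 : 'cV[R]_n) = 0.
Proof. by apply/eqP; rewrite enorm_eq0. Qed.

Lemma enorm_gt0 (R : realType) (n : nat) (x : 'cV[R]_n) : (0 < enorm x) = (x != 0).
Proof. by rewrite lt_def enorm_eq0 enorm_ge0 andbT. Qed.

Lemma enormZ (R : realType) (n : nat) (a : R) (x : 'cV[R]_n) :
  enorm (a *: x) = `|a| * enorm x.
Proof.
by rewrite !enormE dotpZr dotpZl mulrA -expr2 sqrtrM ?sqr_ge0// sqrtr_sqr.
Qed.

Lemma enorm_normalize (R : realType) (n : nat) (x : 'cV[R]_n) :
  x != 0 -> enorm ((enorm x)^-1 *: x) = 1.
Proof.
move=> x0; rewrite enormZ ger0_norm ?invr_ge0 ?enorm_ge0//.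
by rewrite mulVf// enorm_eq0.
Qed.

(** Cauchy-Schwarz, from the nonnegative square of (y . y) x - (x . y) y. *)
Lemma dotp_le_enorm (R : realType) (n : nat) (x y : 'cV[R]_n) :
  dotp x y <= enorm x * enorm y.
Proof.
have [->|y0] := eqVneq y 0.
  by rewrite /dotp mulmx0 mxE mulr_ge0 ?enorm_ge0.
have w0 : 0 < dotp y y by rewrite dotp_gt0.
rewrite (le_trans (ler_norm _))// -ler_sqr ?nnegrE ?mulr_ge0 ?enorm_ge0//.
rewrite real_normK ?num_real// exprMn !enorm_sqr.
have := dotp_ge0 (dotp y y *: x + (- dotp x y) *: y).
rewrite !(dotpDl, dotpDr, dotpZl, dotpZr) (dotpC y x).
set a := dotp x x; set b := dotp x y; set c := dotp y y in w0 *.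
rewrite [X in 0 <= X -> _](_ : _ = c * (a * c - b ^+ 2)); last by ring.
by rewrite pmulr_rge0// subr_ge0.
Qed.

(** Frobenius bound, by Cauchy-Schwarz on each row; the summand 1 keeps the constant positive even
    for M = 0. *)
Lemma enorm_mulmx_bounded (R : realType) (n : nat) (M : 'M[R]_n) :
  exists2 K, 0 < K & forall x : 'cV[R]_n, enorm (M *m x) <= K * enorm x.
Proof.
pose K2 := 1 + \sum_i \sum_j (M i j) ^+ 2.
have s0 : 0 <= \sum_i \sum_j (M i j) ^+ 2.
  by apply: sumr_ge0 => i _; apply: sumr_ge0 => j _; exact: sqr_ge0.
have K0 : 0 < K2 by rewrite /K2; lra.
exists (Num.sqrt K2) => [|x]; first by rewrite sqrtr_gt0.
rewrite -ler_sqr ?nnegrE ?mulr_ge0 ?sqrtr_ge0//.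
rewrite exprMn (sqr_sqrtr (ltW K0)) !enorm_sqr.
apply: (@le_trans _ _ ((\sum_i \sum_j (M i j) ^+ 2) * dotp x x)); last first.
  by rewrite ler_wpM2r ?dotp_ge0// /K2; lra.
rewrite dotpE mulr_suml; apply: ler_sum => i _.
have -> : (M *m x) i 0 = dotp (row i M)^T x.
  by rewrite dotpE mxE; apply: eq_bigr => j _; rewrite !mxE.
have -> : \sum_j (M i j) ^+ 2 = dotp (row i M)^T (row i M)^T.
  by rewrite dotpE; apply: eq_bigr => j _; rewrite !mxE expr2.
rewrite -expr2 -!enorm_sqr -exprMn -real_normK ?num_real//.
rewrite ler_sqr ?nnegrE ?mulr_ge0 ?enorm_ge0//.
rewrite ler_norml dotp_le_enorm andbT lerNl.
rewrite -mulN1r -dotpZr (le_trans (dotp_le_enorm _ _))// enormZ normrN normr1.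
by rewrite mul1r.
Qed.

Lemma qfE (R : realType) (n : nat) (P : 'M[R]_n) (x : 'cV[R]_n) :
  qf P x = dotp x (P *m x).
Proof. by rewrite /qf /dotp mulmxA. Qed.

Lemma qfB_scalar (R : realType) (n : nat) (P : 'M[R]_n) (a : R) (x : 'cV[R]_n) :
  qf (P - a%:M) x = qf P x - a * dotp x x.
Proof.
by rewrite !qfE mulmxBl mul_scalar_mx -scaleNr dotpDr dotpZr mulNr.
Qed.

Lemma qf_gram (R : realType) (n : nat) (L : 'M[R]_n) (x : 'cV[R]_n) :
  qf (L^T *m L) x = enorm (L *m x) ^+ 2.
Proof. by rewrite qfE -mulmxA -dotp_trmx trmxK enorm_sqr. Qed.

(** Induction on the size: the Schur complement [S] of the corner entry is again positive definite,
    and its factor completes a block triangular one. *)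
Lemma cholesky (R : realType) (n : nat) (P : 'M[R]_n) :
  posdef P -> exists L : 'M[R]_n, P = L^T *m L.
Proof.
elim: n P => [|n IH] P; first by exists 0; apply/matrixP => -[].
change 'M[R]_(1 + n) in P => -[symP posP].
pose a := P 0 0; pose b := ursubmx P; pose D := drsubmx P.
have ulP : ulsubmx P = a%:M.
  rewrite [LHS]mx11_scalar !mxE /a; congr ((P _ _)%:M); exact/val_inj.
have defP : P = block_mx a%:M b b^T D.
  rewrite -ulP -[LHS]submxK; congr block_mx.
  by rewrite trmx_ursub symP.
have symD : D^T = D by rewrite trmx_drsub symP.
have a0 : 0 < a.
  have := posP (delta_mx 0 0); rewrite qfE -colE dotpE (bigD1 0)//= big1 => [|i i0].
    rewrite !mxE !eqxx mul1r addr0; apply.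
    by apply/eqP => /matrixP/(_ 0 0); rewrite !mxE !eqxx => /eqP; rewrite oner_eq0.
  by rewrite !mxE (negPf i0) mul0r.
pose S := D - a^-1 *: (b^T *m b).
have posS : posdef S.
  split=> [|x x0].
    by rewrite /Defs.symmetric /S linearB/= linearZ/= trmx_mul trmxK symD.
  (* The upper block cancels the first entry of P y, so the form of [P] at [y] is that of [S] at
     [x]. *)
  pose y : 'cV[R]_(1 + n) := @col_mx R 1 n 1 (- (a^-1 *: (b *m x))) x.
  have y0 : y != 0.
    by apply: contraNneq x0 => y0; rewrite -(col_mxKd (- (a^-1 *: (b *m x))) x) -/y y0 linear0.
  have := posP y y0; rewrite /qf -!mulmxA {1}defP /y (@mul_block_col R 1 n 1 n 1) (@tr_col_mx R 1 n 1).
  rewrite mul_scalar_mx scalerN scalerA divff ?gt_eqF// scale1r addNr.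
  rewrite (@mul_row_col R 1 1 n 1) mulmx0 add0r /S mulmxBl -scalemxAl mulmxN -scalemxAr.
  by rewrite mulmxA addrC.
have [L' defS] := IH _ posS.
pose s := Num.sqrt a.
have s0 : s != 0 by rewrite sqrtr_eq0 -ltNge.
have ss : s * s = a by rewrite -expr2 sqr_sqrtr// ltW.
exists (block_mx s%:M (s^-1 *: b) 0 L').
rewrite (@tr_block_mx R 1 n 1 n) (@mulmx_block R 1 n 1 n 1 n) !(trmx0, mul0mx, mulmx0, addr0) tr_scalar_mx.
rewrite -scalar_mxM ss mul_scalar_mx scalerA divff// scale1r.
rewrite mul_mx_scalar linearZ/= scalerA divff// scale1r.
rewrite -scalemxAl -scalemxAr scalerA -invfM ss -defS [LHS]defP.
by have -> : a^-1 *: (b^T *m b) + S = D by rewrite addrC subrK.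
Qed.

Lemma gram_unitmx (R : realType) (n : nat) (L : 'M[R]_n) :
  posdef (L^T *m L) -> L \in unitmx.
Proof.
move=> [_ posL]; rewrite unitmxE unitfE; apply/negP; rewrite -det_tr.
move=> /det0P[v v0 vL].
have := posL v^T; rewrite qf_gram -[L]trmxK -trmx_mul vL trmx0 enorm0.
rewrite expr0n ltxx => h; suff: false by [].
by apply: h; rewrite -(inj_eq (@trmx_inj _ _ _)) trmxK trmx0.
Qed.

(** With z = P x, w = z . z and q the form at z, the form at (q+1) x - w z equals - w^2 (q+2), which
    forces w = 0. *)
Lemma psd_qf_eq0 (R : realType) (n : nat) (P : 'M[R]_n) (x : 'cV[R]_n) :
  psd P -> qf P x = 0 -> P *m x = 0.
Proof.
move=> [symP psdP] qx; set z := P *m x.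
have zx : dotp x (P *m z) = dotp z z by rewrite -dotp_trmx symP.
set q := qf P z; set w := dotp z z.
have q0 : 0 <= q by exact: psdP.
have q1 : q + 1 != 0 by rewrite gt_eqF//; lra.
have := psdP ((q + 1) *: x + (- w) *: z).
rewrite qfE mulmxDr -!scalemxAr !(dotpDl, dotpDr, dotpZl, dotpZr) zx -!qfE qx.
rewrite -/z -/w -/q [X in 0 <= X -> _](_ : _ = - (w ^+ 2 * (q + 2))); last by ring.
rewrite oppr_ge0 pmulr_lle0; last by lra.
move=> w2; have /eqP : w ^+ 2 = 0 by apply/le_anti; rewrite w2 sqr_ge0.
by rewrite sqrf_eq0 dotp_eq0 => /eqP.
Qed.

(* The largest a with P - a I positive semidefinite is an eigenvalue: otherwise
   P - a I is positive definite, and a Cholesky factor gives room to enlarge a. *)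
Lemma lam_min_psd (R : realType) (n : nat) (P : 'M[R]_n) : (0 < n)%N ->
  psd (P - 1%:M) -> 1 <= lam_min P /\ psd (P - (lam_min P)%:M).
Proof.
move=> n0 psd1; have symP : P^T = P.
  by have [+ _] := psd1; rewrite /Defs.symmetric linearB/= tr_scalar_mx => /addIr.
have symPa a : Defs.symmetric (P - a%:M) by rewrite /Defs.symmetric linearB/= symP tr_scalar_mx.
pose A := [set a | psd (P - a%:M)].
pose e0 : 'cV[R]_n := delta_mx (Ordinal n0) 0.
have e00 : e0 != 0.
  by apply/eqP => /matrixP/(_ (Ordinal n0) 0); rewrite !mxE !eqxx => /eqP; rewrite oner_eq0.
have Aub x : x != 0 -> ubound A (qf P x / dotp x x).
  move=> x0 a [_ /(_ x)]; rewrite qfB_scalar subr_ge0.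
  by rewrite ler_pdivlMr ?dotp_gt0.
have supA : has_sup A.
  by split; [exists 1 | exists (qf P e0 / dotp e0 e0); exact: Aub].
pose a0 := sup A.
have psda0 : psd (P - a0%:M).
  split=> // x; rewrite qfB_scalar subr_ge0.
  have [->|x0] := eqVneq x 0.
    by rewrite /dotp /qf !mulmx0 mxE mulr0.
  rewrite -ler_pdivlMr ?dotp_gt0//; apply: ge_sup => //; first by exists 1.
  exact: Aub.
have eig_ge1 a : eigenvalue P a -> 1 <= a.
  move=> /eigenvalueP[v vP v0].
  have vT0 : v^T != 0 by rewrite -(inj_eq (@trmx_inj _ _ _)) trmxK trmx0.
  have [_ /(_ v^T)] := psd1; rewrite qfB_scalar subr_ge0 mul1r.
  rewrite qfE -dotp_trmx -trmx_mul vP linearZ/= dotpZl.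
  by rewrite -[X in X <= _]mul1r ler_pM2r// dotp_gt0.
have eiga0 : eigenvalue P a0.
  apply: contrapT => neig.
  have posa0 : posdef (P - a0%:M).
    (* A nonzero zero of the form lies in the kernel, hence is an eigenvector; [eigenvalue] speaks
       of row vectors, whence the transpose. *)
    split=> // x x0; have [_ /(_ x)] := psda0; rewrite le_eqVlt => /orP[|//].
    rewrite eq_sym => /eqP /(psd_qf_eq0 psda0).
    rewrite mulmxBl mul_scalar_mx => /eqP; rewrite subr_eq0 => /eqP Px.
    exfalso; apply: neig; apply/eigenvalueP; exists x^T.
      by rewrite -{1}symP -trmx_mul Px linearZ.
    by rewrite -(inj_eq (@trmx_inj _ _ _)) trmxK trmx0.
  have [L defL] := cholesky posa0.
  have uL : L \in unitmx by apply: gram_unitmx; rewrite -defL.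
  have [K K0 hK] := enorm_mulmx_bounded (invmx L).
  (* Since |x| <= K |L x|, the form dominates K^-2 |x|^2, against the maximality of [a0]. *)
  have : A (a0 + (K ^+ 2)^-1).
    split=> // x; rewrite qfB_scalar mulrDl opprD addrA -qfB_scalar defL qf_gram.
    rewrite subr_ge0 ler_pdivrMl ?exprn_gt0// -enorm_sqr -exprMn.
    rewrite ler_sqr ?nnegrE ?mulr_ge0 ?enorm_ge0 ?(ltW K0)//.
    by rewrite -{1}(mulKmx uL x).
  move=> /(ub_le_sup supA.2); rewrite -/a0.
  by rewrite gerDl leNgt invr_gt0 exprn_gt0.
have eig_lb : lbound [set a | eigenvalue P a] 1 by move=> a; exact: eig_ge1.
split; first by apply: lb_le_inf => //; exists a0.
(* As [a0] is an eigenvalue, [lam_min P] is at most [a0]. *)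
split=> // x; have [_ /(_ x)] := psda0; rewrite !qfB_scalar !subr_ge0.
apply: le_trans; rewrite ler_wpM2r ?dotp_ge0//.
by apply: ge_inf => //; exists 1.
Qed.

(** * Caps and the function delta *)

Lemma continuous_sumr (R : realType) (T : topologicalType) (I : Type) (r : seq I)
    (f : I -> T -> R) : (forall i, continuous (f i)) ->
  continuous (fun x => \sum_(i <- r) f i x).
Proof.
move=> cf; elim: r => [|i r IH] x.
  rewrite (_ : (fun x => _) = fun=> 0); first exact: cvg_cst.
  by apply/funext => y; rewrite big_nil.
rewrite (_ : (fun x => _) = fun y => f i y + \sum_(j <- r) f j y); last first.
  by apply/funext => y; rewrite big_cons.
by apply: cvgD; [exact: cf | exact: IH].
Qed.

Lemma borel_cap (R : realType) (n : nat) (c : 'cV[R]_n) (s : R) :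
  borel (@Sph R n `&` [set y | s < dotp c y]).
Proof.
have coord i : continuous (fun y : 'cV[R]_n => y i 0) by exact: coord_continuous.
have cd : continuous (fun y : 'cV[R]_n => dotp c y).
  rewrite (_ : (fun y => _) = fun y : 'cV[R]_n => \sum_i c i 0 * y i 0); last first.
    by apply/funext => z; rewrite dotpE.
  apply: continuous_sumr => i x; apply: (@continuousM _ _ (fun=> c i 0)).
    exact: cst_continuous.
  exact: coord.
have cq : continuous (fun y : 'cV[R]_n => \sum_i y i 0 * y i 0).
  by apply: continuous_sumr => i x; apply: continuousM; exact: coord.
have o1 : open [set y : 'cV[R]_n | s < dotp c y].
  apply: (@open_comp _ _ (fun y : 'cV[R]_n => dotp c y) [set x | s < x]); last exact: open_gt.
  by move=> y _; exact: cd.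
have o2 : open (~` @Sph R n).
  rewrite (_ : ~` _ = (fun y : 'cV[R]_n => \sum_i y i 0 * y i 0) @^-1` [set x | x != 1]).
    apply: open_comp; last first.
      rewrite (_ : [set x | _] = ~` [set x | x = 1]).
        by rewrite openC; exact: closed_eq.
      by apply/seteqP; split=> x /= /eqP.
    by move=> y _; exact: cq.
  apply/seteqP; split=> y /= h; rewrite -dotpE -?enorm_sqr in h *.
    by apply/eqP => /eqP; rewrite sqrp_eq1 ?enorm_ge0// => /eqP.
  by move=> h1; move: h; rewrite h1 expr1n eqxx.
pose G := [set A : set 'cV[R]_n | open A].
rewrite /borel -/G; have sub A : open A -> <<s G >> A by move=> oA; exact: sub_sigma_algebra.
have := @measurableI _ (g_sigma_algebraType G) (@Sph R n) [set y | s < dotp c y].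
apply; last exact: sub.
by rewrite -[Sph (n:=n)]setCK; apply: measurableC; exact: sub.
Qed.

(** Outside the cap the sphere lies in the half space c . y <= s, hence so does its hull; the point
    r c of the hull then gives r <= s. *)
Lemma Delta_cap_le (R : realType) (n : nat) (c : 'cV[R]_n) (s : R) :
  enorm c = 1 -> 0 <= s -> Delta (@Sph R n `&` [set y | s < dotp c y]) <= s.
Proof.
move=> c1 s0; rewrite /Delta; set D := (X in sup X).
have Ds r : D r -> r <= s.
  move=> [_ rB]; have [|k [p [w [Sp [w0 [w1 rc]]]]]] := rB (r *: c).
    by exists c => //; rewrite /Ball /= c1.
  have -> : r = dotp c (r *: c) by rewrite dotpZr -enorm_sqr c1 expr1n mulr1.
  have dsum : dotp c (\sum_i w i *: p i) = \sum_i w i * dotp c (p i).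
    elim/big_rec2: _ => [|i x y _ <-]; first by rewrite /dotp mulmx0 mxE.
    by rewrite dotpDr dotpZr.
  rewrite rc dsum -[s]mul1r -w1 mulr_suml; apply: ler_sum => i _.
  have [S1 S2] := Sp i; rewrite ler_wpM2l// leNgt; apply/negP => h.
  by apply: S2.
have [->|/set0P D0] := eqVneq D set0; first by rewrite sup0.
by apply: ge_sup.
Qed.

Lemma delta_le (R : realType) (n : nat) (e : R) (X : set 'cV[R]_n) :
  borel X -> X `<=` @Sph R n -> sigma_sph X <= e -> delta n e <= Delta X.
Proof.
move=> bX XS sX; apply: ge_inf; last by exists X.
exists 0 => _ [Y _ <-]; rewrite /Delta; set D := (X in sup X).
have [->|/set0P[r Dr]] := eqVneq D set0; first by rewrite sup0.
apply: (@le_trans _ _ r); first by case: Dr => /andP[].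
by apply: ub_le_sup => //; exists 1 => x [/andP[]].
Qed.

Lemma sqrtr_exprn (R : realType) (x : R) (k : nat) :
  0 <= x -> Num.sqrt (x ^+ k) = Num.sqrt x ^+ k.
Proof.
by move=> x0; elim: k => [|k IH]; rewrite ?expr0 ?sqrtr1// !exprS sqrtrM// IH.
Qed.

(** Identifies [kappa] as the factor by which the map lambda_min^(-1/2) L scales volume. *)
Lemma kappa_gram (R : realType) (n : nat) (L : 'M[R]_n) :
  0 < lam_min (L^T *m L) ->
  kappa (L^T *m L) = `|\det ((Num.sqrt (lam_min (L^T *m L)))^-1 *: L)|.
Proof.
move=> lam0; rewrite /kappa detZ normrM det_mulmx det_tr -expr2.
rewrite sqrtrM ?sqr_ge0// sqrtr_sqr mulrC; congr (_ * _).
rewrite normrX normfV ger0_norm ?sqrtr_ge0// exprVn sqrtrV ?exprn_ge0 ?(ltW lam0)//.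
by rewrite sqrtr_exprn// ltW.
Qed.

Lemma cone_sub_Ball (R : realType) (n : nat) (X : set 'cV[R]_n) :
  X `<=` @Sph R n -> cone X `<=` @Ball R n.
Proof.
move=> XS _ [x [t [/XS Sx [/andP[t0 t1] ->]]]].
by rewrite /Ball /= enormZ Sx mulr1 ger0_norm.
Qed.

(* In the coordinates y = L x the set G contains the image of every direction
   outside St. If G missed the cap {y : c . y > s} it would also miss the
   opposite one, so St would fill both; this forces the measure of one cap
   below half of the distorted measure of St, hence delta <= s. *)
Lemma cap_meets_good (R : realType) (n : nat) (L : 'M[R]_n) (eps : R)
    (St G : set 'cV[R]_n) (c : 'cV[R]_n) (s : R) : (0 < n)%N ->
  psd (L^T *m L - 1%:M) -> St `<=` @Sph R n -> sigma_sph St <= eps ->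
  (forall x, Sph x -> ~ St x -> G (L *m x)) ->
  (forall a y, G y -> G (a *: y)) ->
  enorm c = 1 -> 0 <= s -> s < delta n (eps * kappa (L^T *m L) / 2) ->
  exists g, [/\ Sph g, s < dotp c g & G g].
Proof.
move=> n0 psd1 StS sSt GSt GZ c1 s0 sd; apply: contrapT => noG.
pose X := @Sph R n `&` [set y | s < dotp c y].
have XS : X `<=` @Sph R n by move=> y [].
have XG y : X y -> ~ G y by move=> [y1 y2] Gy; apply: noG; exists y.
move: sd; rewrite ltNge => /negP; apply.
apply: le_trans (Delta_cap_le c1 s0).
apply: delta_le => //; first exact: borel_cap.
rewrite -/X.
have [lam1 psdlam] := lam_min_psd n0 psd1.
have lam0 : 0 < lam_min (L^T *m L) by exact: lt_le_trans lam1.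
have kapE := kappa_gram lam0.
set kap := kappa _ in kapE *; set lam := lam_min _ in lam1 psdlam lam0 kapE.
have posLL : posdef (L^T *m L).
  split; first by rewrite /Defs.symmetric trmx_mul trmxK.
  move=> x x0; have [_ /(_ x)] := psdlam; rewrite qfB_scalar subr_ge0.
  by apply: lt_le_trans; rewrite mulr_gt0// dotp_gt0.
have uL := gram_unitmx posLL.
pose q := Num.sqrt lam; have q0 : 0 < q by rewrite sqrtr_gt0.
have qL x : q * enorm x <= enorm (L *m x).
  rewrite -ler_sqr ?nnegrE ?mulr_ge0 ?enorm_ge0 ?(ltW q0)//.
  rewrite exprMn (sqr_sqrtr (ltW lam0)) enorm_sqr -qf_gram -subr_ge0 -qfB_scalar.
  by have [] := psdlam.
pose M := q^-1 *: L.
have uM : M \in unitmx by rewrite unitmxZ// unitfE invr_neq0// gt_eqF.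
(* The sign [e] treats a vector of the cap and its opposite together. *)
have XM e y : `|e| = 1 -> cone X y -> (mulmx M @` cone St) (e *: y).
  move=> e1 [y0 [t [Xy0 [/andP[t0 t1] ->]]]].
  have e0 : e != 0 by rewrite -normr_eq0 e1 oner_neq0.
  pose z := invmx L *m y0; have Lz : L *m z = y0 by rewrite mulKVmx.
  have z0 : z != 0.
    apply/eqP => z0; have := XS _ Xy0; rewrite /Sph /= -Lz z0 mulmx0.
    by rewrite enorm0 => /esym/eqP; rewrite oner_eq0.
  have nz : enorm z != 0 by rewrite enorm_eq0.
  (* The unit direction that [L] sends to the line of [y0]; it lies in [St] because [G] is invariant
     under scaling. *)
  pose x := (e / enorm z) *: z.
  have Sx : Sph x.
    by rewrite /Sph /= enormZ normrM e1 mul1r -enormZ enorm_normalize.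
  have Stx : St x.
    apply: contrapT => nSt; apply: (XG _ Xy0).
    have := GZ (enorm z / e) _ (GSt _ Sx nSt).
    rewrite /x -scalemxAr Lz scalerA (_ : _ * _ = 1) ?scale1r//.
    by rewrite mulrA divfK ?divff.
  (* The factor is at most 1, since q |z| <= |L z| = |y0| = 1. *)
  exists ((t * (q * enorm z)) *: x).
    exists x, (t * (q * enorm z)); split=> //; split=> //.
    rewrite mulr_ge0 ?mulr_ge0 ?enorm_ge0 ?(ltW q0)//=.
    rewrite mulr_ile1 ?mulr_ge0 ?enorm_ge0 ?(ltW q0)//.
    by apply: (le_trans (qL z)); rewrite Lz (XS _ Xy0).
  rewrite /M /x -!scalemxAr -scalemxAl Lz !scalerA; congr (_ *: _).
  by field; rewrite nz gt_eqF.
have half : (lebesgue_n (cone X) + lebesgue_n (cone X) <= kap%:E * lebesgue_n (cone St))%E.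
  rewrite kapE; apply: le_trans (lebesgue_n_mulmx _ uM).
  apply: (@lebesgue_n_antipodal _ _ c).
  - by rewrite -enorm_eq0 c1 oner_neq0.
  - move=> y [y0 [t [[_ sy0] [/andP[t0 _] ->]]]]; rewrite dotpZr mulr_ge0//.
    exact: (le_trans s0 (ltW sy0)).
  - move=> y Xy; split; first by rewrite -[y]scale1r; apply: XM; rewrite ?normr1.
    by rewrite -scaleN1r; apply: XM; rewrite ?normrN1.
have kap0 : 0 <= kap by exact: sqrtr_ge0.
have finX := lebesgue_n_bounded n0 (cone_sub_Ball XS).
have finSt := lebesgue_n_bounded n0 (cone_sub_Ball StS).
move: half; rewrite -(fineK finX) -(fineK finSt) -EFinD -EFinM lee_fin.
rewrite /sigma_sph in sSt *.
set a := fine _; set b := fine _ in sSt *; set v := fine _ in sSt * => half.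
have v0 : 0 <= v^-1 by rewrite invr_ge0 fine_ge0// lebesgue_n_ge0.
have h1 : a / v <= kap * b / 2 / v by rewrite ler_wpM2r//; lra.
apply: (le_trans h1); rewrite (_ : kap * b / 2 / v = b / v * (kap / 2)); last by ring.
by rewrite -[leRHS]mulrA ler_wpM2r// divr_ge0.
Qed.

Lemma enorm_mulmx_dual (R : realType) (n : nat) (M : 'M[R]_n) (b d : R) :
  0 <= b -> 0 <= d ->
  (forall c s, enorm c = 1 -> 0 <= s -> s < d ->
     exists g, [/\ Sph g, s < dotp c g & enorm (M *m g) <= b]) ->
  forall v, d * enorm (M *m v) <= b * enorm v.
Proof.
move=> b0 d0 hM.
have hT u : d * enorm (M^T *m u) <= b * enorm u.
  have [->|Mu0] := eqVneq (M^T *m u) 0.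
    by rewrite enorm0 mulr0 mulr_ge0 ?enorm_ge0.
  have a0 : 0 < enorm (M^T *m u) by rewrite enorm_gt0.
  rewrite leNgt; apply/negP => lt.
  (* With this [s], the inequality s < c . g reads u . M g > b |u|, against Cauchy-Schwarz. *)
  have [||g [Sg sg Mg]] := hM _ (b * enorm u / enorm (M^T *m u)) (enorm_normalize Mu0).
  - by rewrite divr_ge0 ?mulr_ge0 ?enorm_ge0.
  - by rewrite ltr_pdivrMr.
  move: sg; rewrite dotpZl mulrC ltr_pM2l ?invr_gt0// dotp_trmx ltNge => /negP; apply.
  apply: (le_trans (dotp_le_enorm _ _)).
  by rewrite mulrC ler_wpM2r ?enorm_ge0.
move=> v; have [->|Mv0] := eqVneq (M *m v) 0.
  by rewrite enorm0 mulr0 mulr_ge0 ?enorm_ge0.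
have a0 : 0 < enorm (M *m v) by rewrite enorm_gt0.
(* The bound passes from the transpose to [M] through |M v|^2 = (M^T M v) . v. *)
rewrite -(ler_pM2r a0) -mulrA -expr2 enorm_sqr -dotp_trmx.
apply: (@le_trans _ _ (d * (enorm (M^T *m (M *m v)) * enorm v))).
  by rewrite ler_wpM2l// dotp_le_enorm.
by rewrite mulrA [leRHS]mulrAC ler_wpM2r ?enorm_ge0.
Qed.

(** * The joint spectral radius *)

Lemma foldl_mulmx (R : realType) (n m : nat) (A : 'I_m -> 'M[R]_n)
    (s : seq 'I_m) (M : 'M[R]_n) :
  foldl (fun M i => A i *m M) M s = foldl (fun M i => A i *m M) 1%:M s *m M.
Proof.
elim: s M => [|i s IH] M /=; first by rewrite mul1mx.
by rewrite IH [in RHS]IH mulmx1 mulmxA.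
Qed.

Lemma enorm_word_le (R : realType) (n m l : nat) (A : 'I_m -> 'M[R]_n)
    (L : 'M[R]_n) (b : R) : 0 <= b ->
  (forall (j : l.-tuple 'I_m) v,
     enorm (L *m (Aw A j *m v)) <= b * enorm (L *m v)) ->
  forall k (w : (k * l).-tuple 'I_m) v,
    enorm (L *m (Aw A w *m v)) <= b ^+ k * enorm (L *m v).
Proof.
move=> b0 hb k [s szs] v; rewrite /Aw /=; move/eqP: szs => sz.
elim: k s sz v => [|k IH] s sz v.
  by rewrite (size0nil sz) /= mul1mx expr0 mul1r.
have szt : size (take l s) == l by rewrite size_take_min sz mulSn (minn_idPl (leq_addr _ _)).
(* The first [l] letters act first; [k] blocks of length [l] remain. *)
rewrite -(cat_take_drop l s) foldl_cat foldl_mulmx -mulmxA.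
apply: (le_trans (IH _ _ _)); first by rewrite size_drop sz mulSn addKn.
rewrite exprSr -mulrA ler_wpM2l ?exprn_ge0//.
exact: (hb (Tuple szt)).
Qed.

Lemma opnorm_le (R : realType) (n : nat) (M : 'M[R]_n) (C : R) : (0 < n)%N ->
  (forall x, Sph x -> enorm (M *m x) <= C) -> opnorm M <= C.
Proof.
move=> n0 hC; apply: ge_sup => [|_ [x Sx <-]]; last exact: hC.
pose e : 'cV[R]_n := delta_mx (Ordinal n0) 0.
have e0 : e != 0.
  by apply/eqP => /matrixP/(_ (Ordinal n0) 0); rewrite !mxE !eqxx => /eqP; rewrite oner_eq0.
by exists (enorm (M *m ((enorm e)^-1 *: e))), ((enorm e)^-1 *: e) => //; exact: enorm_normalize.
Qed.

(* It suffices to bound the subsequence of word lengths k * l. If the sequence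
   did not converge, jsr would be the junk value 0. *)
Lemma jsr_le (R : realType) (n m l : nat) (A : 'I_m -> 'M[R]_n)
    (L : 'M[R]_n) (b : R) : (0 < n)%N -> (0 < l)%N -> 0 < b ->
  (forall z : 'cV[R]_n, enorm z <= enorm (L *m z)) ->
  (forall (j : l.-tuple 'I_m) v,
     enorm (L *m (Aw A j *m v)) <= b * enorm (L *m v)) ->
  jsr A <= powR b l%:R^-1.
Proof.
move=> n0 l0 b0 hL hb; rewrite /jsr; set u := (X in limn X).
have [cu|ncu] := pselect (cvgn u); last by rewrite (dvgP ncu) powR_ge0.
have [K K0 hK] := enorm_mulmx_bounded L.
(* Going to the norm |L x| and back costs one factor [K] for the whole word. The shift [k.+1] avoids
   the empty word. *)
have ub k : u (k.+1 * l)%N <= powR K (k.+1 * l)%:R^-1 * powR b l%:R^-1.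
  have kl0 : (k.+1 * l)%:R != 0 :> R by rewrite pnatr_eq0 muln_eq0 /= -lt0n.
  have -> : powR b l%:R^-1 = powR (b ^+ k.+1) (k.+1 * l)%:R^-1.
    rewrite -powR_mulrn ?(ltW b0)// -powRrM natrM; congr powR.
    by rewrite invfM mulVKf ?pnatr_eq0.
  rewrite -powRM ?(ltW K0) ?exprn_ge0 ?(ltW b0)//.
  have Kb0 : 0 <= K * b ^+ k.+1 by rewrite mulr_ge0 ?exprn_ge0 ?ltW.
  have max0 : 0 <= \big[Num.max/0]_(w : (k.+1 * l).-tuple 'I_m) opnorm (Aw A w).
    by rewrite bigmax_ge_id.
  apply: ge0_ler_powR => //; rewrite ?invr_ge0 ?ler0n//.
  apply: bigmax_le => // w _; apply: opnorm_le => // x Sx.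
  apply: (le_trans (hL _)); apply: (le_trans (enorm_word_le (ltW b0) hb w x)).
  rewrite mulrC ler_wpM2r ?exprn_ge0 ?(ltW b0)//.
  by apply: (le_trans (hK x)); rewrite Sx mulr1.
have sub : (fun k => u (k.+1 * l)%N) @ \oo --> limn u.
  apply: cvg_comp cu => P [N _ NP]; exists N => // k /= Nk; apply: NP => /=.
  by apply: (leq_trans Nk); rewrite mulSn (leq_trans (leq_pmulr k l0))// leq_addl.
(* The roots of the constant [K] tend to 1. *)
have bound_cvg : (fun k : nat => powR K (k.+1 * l)%:R^-1 * powR b l%:R^-1) @ \oo -->
    powR b l%:R^-1.
  rewrite -[X in _ --> X]mul1r; apply: cvgMl.
  have -> : (fun k : nat => powR K (k.+1 * l)%:R^-1) =
      (fun k => expR (l%:R^-1 * ln K * k.+1%:R^-1)).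
    by apply/funext => k; rewrite /powR gt_eqF// natrM invfM; congr expR; ring.
  rewrite -[X in _ --> X]expR0 -[X in _ --> expR X](mulr0 (l%:R^-1 * ln K)).
  apply: (@cvg_comp _ _ _ (fun k : nat => l%:R^-1 * ln K * k.+1%:R^-1) expR).
    by apply: cvgMr; exact: cvg_harmonic.
  exact: continuous_expR.
by apply: (ler_cvg_to sub bound_cvg); apply: nearW.
Qed.

Theorem theorem5 (R : realType) (n m l : nat) (A : 'I_m -> 'M[R]_n)
    (gs eta eps : R) (om : seq ('cV[R]_n * l.-tuple 'I_m))
    (P : 'M[R]_n) (St : set 'cV[R]_n) :
  (0 < n)%N -> (0 < m)%N -> (0 < l)%N -> 0 < gs ->
  0 < eta -> is_sample om -> posdef P -> opt_solution A om eta P ->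
  borel St -> St `<=` @Sph R n -> sigma_sph St <= eps ->
  (forall (x : 'cV[R]_n) (j : l.-tuple 'I_m), @Sph R n x -> ~ St x ->
     qf P (Aw A j *m x) <= gs ^+ (2 * l) * qf P x) ->
  0 < delta n (eps * kappa P / 2) ->
  jsr A <= gs / powR (delta n (eps * kappa P / 2)) l%:R^-1.
Proof.
move=> n0 _ l0 gs0 _ _ posP [[_ [psd1 _]] _] _ StS sSt hSt d0.
have [L defP] := cholesky posP.
have uL : L \in unitmx by apply: gram_unitmx; rewrite -defP.
set d := delta _ _ in d0 *.
have gsl : 0 <= gs ^+ l by rewrite exprn_ge0 // ltW.
have -> : gs / powR d l%:R^-1 = powR (gs ^+ l / d) l%:R^-1.
  rewrite powRM// ?invr_ge0 ?(ltW d0)//.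
  have l1 : l%:R != 0 :> R by rewrite pnatr_eq0 -lt0n.
  rewrite -powR_mulrn ?(ltW gs0)// -powRrM divff// powRr1 ?(ltW gs0)//.
  by rewrite -(powR_inv1 (ltW d0)) -powRrM mulN1r powRN.
(* Goodness is asked for all words at once, and in homogeneous form so that scaling preserves it. *)
pose good (y : 'cV[R]_n) := forall j : l.-tuple 'I_m,
  enorm (L *m Aw A j *m invmx L *m y) <= gs ^+ l * enorm y.
apply: (jsr_le (L := L)) => //; first by rewrite divr_gt0 ?exprn_gt0.
  (* Feasibility gives P >= I, that is, |z| <= |L z|. *)
  move=> z; rewrite -ler_sqr ?nnegrE ?enorm_ge0// -qf_gram -defP enorm_sqr.
  by rewrite -subr_ge0 -[dotp z z]mul1r -qfB_scalar; case: psd1.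
move=> j v; pose M := L *m Aw A j *m invmx L.
have -> : L *m (Aw A j *m v) = M *m (L *m v) by rewrite -!mulmxA mulKmx.
rewrite mulrAC ler_pdivlMr// mulrC.
apply: enorm_mulmx_dual => //; first exact: ltW.
move=> c s c1 s0 sd.
have [||||g [Sg sg gg]] := @cap_meets_good _ _ L eps St good c s n0 _ StS sSt _ _ c1 s0 _.
- by rewrite -defP.
- move=> x Sx nSt i; rewrite -mulmxA mulKmx// -mulmxA.
  rewrite -ler_sqr ?nnegrE ?mulr_ge0 ?enorm_ge0// exprMn -exprM mulnC.
  by rewrite -!qf_gram -defP; exact: hSt.
- by move=> a y gy i; rewrite -scalemxAr !enormZ mulrCA ler_wpM2l.
- by rewrite -defP.
by exists g; split=> //; have := gg j; rewrite Sg mulr1.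
Qed.
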